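(* Let $0<\mu\le L$, $\kappa=L/\mu$, $f\in S_{\mu,L}(\mathbb{R}^d)$, and let $\Delta\ge f(x_0^0)-f^*$ be given. Let $\epsilon\in(0,\Delta)$. Run the algorithm M-ASG with $\alpha_1=\frac1L$, $n_1=\left\lceil\sqrt{\kappa}\log\left(\frac{4\Delta}{\epsilon}\right)\right\rceil$ and, for $k\ge2$, $n_k=2^k\lceil\sqrt{\kappa}\log(8)\rceil$ and $\alpha_k=\frac{1}{2^{2k}L}$. Then within at most $$n_\epsilon=\left\lceil\sqrt{\kappa}\log\left(\frac{4\Delta}{\epsilon}\right)\right\rceil+\left\lceil16(1+\log(8))\frac{\sigma^2}{\mu\epsilon}\right\rceil$$ iterations (stochastic gradient steps) in total, the algorithm computes an $\epsilon$-solution, i.e. an iterate $x_\epsilon$ with $\mathbb{E}[f(x_\epsilon)]-f^*\le\epsilon$.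
   Context: $S_{\mu,L}(\mathbb{R}^d)$ is the set of continuously differentiable $f:\mathbb{R}^d\to\mathbb{R}$ with $\frac{\mu}{2}\|x-y\|^2\le f(x)-f(y)-\nabla f(y)^\top(x-y)\le\frac L2\|x-y\|^2$ for all $x,y$. $x^*$ is the unique minimizer of $f$, $f^*=f(x^* )$; $\log$ is the natural logarithm. Stochastic oracle with noise level $\sigma\ge0$: each time the algorithm needs a gradient at a query point $z$ (a function of the initial point and of the randomness used in earlier queries), it receives $\tilde\nabla f(z,w)$, where the random variables $w$ used in the different queries are independent, so that $w$ is independent of all the past, and $\mathbb{E}[\tilde\nabla f(z,w)\mid z]=\nabla f(z)$, $\mathbb{E}[\|\tilde\nabla f(z,w)-\nabla f(z)\|^2\mid z]\le\sigma^2$. M-ASG (Multistage Accelerated Stochastic Gradient) with stage lengths $n_k\in\mathbb{N}$ and stepsizes $\alpha_k\in(0,1/L]$, from a deterministic initial point $x_0^0\in\mathbb{R}^d$: for stages $k=1,2,\dots$, let $\beta_k=\frac{1-\sqrt{\mu\alpha_k}}{1+\sqrt{\mu\alpha_k}}$; set $x_0^k=x_1^k=x_{n_{k-1}+1}^{k-1}$ (for $k=1$: $x_0^1=x_1^1=x_0^0$); and for $m=1,\dots,n_k$ set $y_m^k=(1+\beta_k)x_m^k-\beta_k x_{m-1}^k$ and $x_{m+1}^k=y_m^k-\alpha_k\tilde\nabla f(y_m^k,w_m^k)$. Each inner step $m$ is one iteration. *)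

(* Defs.v *)
From mathcomp Require Import all_boot all_order all_algebra finmap.
From mathcomp Require Import all_classical all_reals all_analysis.
Import Order.TTheory GRing.Theory Num.Theory.
Import numFieldNormedType.Exports.

Set Implicit Arguments.
Unset Strict Implicit.
Unset Printing Implicit Defensive.

Local Open Scope classical_set_scope.
Local Open Scope ring_scope.

(* To be used on nonnegative reals only, where it is the usual ceiling. *)
Definition nceil (R : realType) (x : R) : nat := `|Num.ceil x|%N.

Section Euclidean.
Context {R : realType} {d : nat}.

(* The library norm on ['rV[R]_d] is the sup norm; it induces the same topology,
   differentiability and Borel sets, but norms in inequalities are Euclidean. *)
Definition dotv (u v : 'rV[R]_d) : R := \sum_(i < d) u ord0 i * v ord0 i.

Definition enorm (u : 'rV[R]_d) : R := Num.sqrt (dotv u u).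

Definition gradient (f : 'rV[R]_d -> R) (x : 'rV[R]_d) : 'rV[R]_d :=
  \row_(i < d) 'D_(delta_mx ord0 i) f x.

Definition smooth_strongly_convex (mu L : R) (f : 'rV[R]_d -> R) : Prop :=
  [/\ forall x, differentiable f x,
      continuous (gradient f)
    & forall x y, mu / 2 * enorm (x - y) ^+ 2
        <= f x - f y - dotv (gradient f y) (x - y)
        <= L / 2 * enorm (x - y) ^+ 2].

End Euclidean.

(* ['rV[R]_d] with its Borel sigma-algebra. *)
Notation borel_rV R d := (g_sigma_algebraType (@open 'rV[R]_d)).

Section Probability.
Context {R : realType} {dO : measure_display} {Omega : measurableType dO}.
Variable P : probability Omega R.

Definition mutually_independent {dW : measure_display} {W : measurableType dW}
    {I : choiceType} (D : set I) (X : I -> {RV P >-> W}) : Prop :=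
  forall (J : {fset I}) (A : I -> set W),
    [set` J] `<=` D -> (forall i, measurable (A i)) ->
    P (\bigcap_(i in [set` J]) (X i @^-1` A i)) =
    (\prod_(i <- J) P (X i @^-1` A i))%E.

(* [V] is a version of the conditional expectation E[X | G], where [G] is a
   sub-sigma-algebra given by its collection of events. *)
Definition is_cond_expectation (G : set (set Omega)) (X V : Omega -> R) : Prop :=
  [/\ P.-integrable setT (EFin \o X),
      P.-integrable setT (EFin \o V),
      forall B : set R, measurable B -> G (V @^-1` B)
    & forall A, G A ->
        (\int[P]_(o in A) (X o)%:E = \int[P]_(o in A) (V o)%:E)%E].

Definition sigma_of {d : nat} (z : Omega -> 'rV[R]_d) : set (set Omega) :=
  preimage_set_system setT z (@measurable _ (borel_rV R d)).

(* Answer [g z w] of the oracle at the random query point [z]: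
   E[g(z,w) | z] = grad f(z), coordinatewise, and
   E[|g(z,w) - grad f(z)|^2 | z] <= sigma^2 almost surely. *)
Definition noisy_gradient {d : nat} {W : Type} (f : 'rV[R]_d -> R) (sigma : R)
    (g : 'rV[R]_d -> W -> 'rV[R]_d)
    (z : Omega -> 'rV[R]_d) (w : Omega -> W) : Prop :=
  (forall i : 'I_d, is_cond_expectation (sigma_of z)
     (fun o => g (z o) (w o) ord0 i) (fun o => gradient f (z o) ord0 i)) /\
  (exists2 V : Omega -> R,
     is_cond_expectation (sigma_of z)
       (fun o => enorm (g (z o) (w o) - gradient f (z o)) ^+ 2) V
     & {ae P, forall o, V o <= sigma ^+ 2}).

End Probability.

Section MASG.
Context {R : realType} {d : nat} {W : Type}.
Variables (g : 'rV[R]_d -> W -> 'rV[R]_d) (mu : R).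

Definition momentum (alpha : R) : R :=
  (1 - Num.sqrt (mu * alpha)) / (1 + Num.sqrt (mu * alpha)).

Definition extrapolate (alpha : R) (xprev x : 'rV[R]_d) : 'rV[R]_d :=
  (1 + momentum alpha) *: x - momentum alpha *: xprev.

(* One stage started at [x0 = x1 = x]: the pair [(x_m, x_(m+1))]; the noise of
   inner step [m >= 1] is [w m]. *)
Fixpoint asg (alpha : R) (w : nat -> W) (x : 'rV[R]_d) (m : nat) :
    'rV[R]_d * 'rV[R]_d :=
  if m is m'.+1 then
    let: (xprev, xcur) := asg alpha w x m' in
    let y := extrapolate alpha xprev xcur in
    (xcur, y - alpha *: g y (w m))
  else (x, x).

Variables (alpha : nat -> R) (n : nat -> nat) (x00 : 'rV[R]_d).
Variable w : nat -> nat -> W.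

(* [x_0^k = x_1^k]; stages are numbered from 1, and stage 0 is a dummy. *)
Fixpoint masg_init (k : nat) : 'rV[R]_d :=
  if k is j.+1 then
    if j is 0 then x00 else (asg (alpha j) (w j) (masg_init j) (n j)).2
  else x00.

Definition masg_x (k m : nat) : 'rV[R]_d :=
  (asg (alpha k) (w k) (masg_init k) m).1.

(* Query point of inner step [m >= 1] of stage [k >= 1]. *)
Definition masg_y (k m : nat) : 'rV[R]_d :=
  extrapolate (alpha k) (masg_x k m.-1) (masg_x k m).

End MASG.

(* The pairs (stage, inner step) at which the oracle is called. *)
Definition masg_queries (n : nat -> nat) : set (nat * nat) :=
  [set q | (0 < q.1)%N && (0 < q.2 <= n q.1)%N].

(* Main.v *)
(* Write e_k for the expected optimality gap at the start of stage k.  Within a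
   stage with stepsize alpha and s = sqrt (mu alpha), the Lyapunov function
     V = f x_m - f xstar + mu/2 |v|^2,
     v = (x_m - xstar - (1 - s)(x_(m-1) - xstar)) / s,
   satisfies E V_(m+1) <= (1 - s) E V_m + alpha/2 (1 + alpha L) sigma^2: the
   inequality holds pathwise up to a term that is linear in the noise, and that
   term has mean zero because the current noise is independent of the past.  As
   V <= 2 (f x - f xstar) at a restart, e_(k+1) <= 2 exp (- s n_k) e_k + alpha sigma^2 / s,
   and the schedule turns this into e_(k+1) <= eps/2 4^-(k-1) + a 2^-(k-1) with
   a = sigma^2 / (mu sqrt kappa).  Stopping after the first stage with
   a 2^-(k-1) <= eps/2 gives the iteration count, since then 2^(k+1) < 16 a / eps. *)
Require Import Defs.
From HB Require Import structures.
From mathcomp Require Import all_boot all_order all_algebra finmap.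
From mathcomp Require Import all_classical all_reals all_analysis.
From mathcomp Require Import measurable_realfun ring lra zify.
Import Order.TTheory GRing.Theory Num.Theory.
Import numFieldNormedType.Exports.
Set Implicit Arguments.
Unset Strict Implicit.
Unset Printing Implicit Defensive.

Local Open Scope classical_set_scope.
Local Open Scope ring_scope.

(** * The pathwise descent inequality *)

Section InnerProduct.
Context {R : realType} {d : nat}.
Implicit Types u v : 'rV[R]_d.

Lemma dotvC u v : dotv u v = dotv v u.
Proof. by apply: eq_bigr => i _; rewrite mulrC. Qed.

Lemma dotvDl u v z : dotv (u + v) z = dotv u z + dotv v z.
Proof. by rewrite -big_split; apply: eq_bigr => i _; rewrite mxE mulrDl. Qed.

Lemma dotvZl a u v : dotv (a *: u) v = a * dotv u v.
Proof. by rewrite mulr_sumr; apply: eq_bigr => i _; rewrite mxE mulrA. Qed.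

Lemma dotvDr u v z : dotv u (v + z) = dotv u v + dotv u z.
Proof. by rewrite dotvC dotvDl !(dotvC u). Qed.

Lemma dotvZr a u v : dotv u (a *: v) = a * dotv u v.
Proof. by rewrite dotvC dotvZl dotvC. Qed.

Lemma dotvNl u v : dotv (- u) v = - dotv u v.
Proof. by rewrite -scaleN1r dotvZl mulN1r. Qed.

Lemma dotvNr u v : dotv u (- v) = - dotv u v.
Proof. by rewrite dotvC dotvNl dotvC. Qed.

Lemma dotv0l u : dotv 0 u = 0.
Proof. by rewrite -(scale0r 0) dotvZl mul0r. Qed.

Definition dotvE := (dotvDl, dotvDr, dotvZl, dotvZr, dotvNl, dotvNr).

Lemma dotv_ge0 u : 0 <= dotv u u.
Proof. by apply: sumr_ge0 => i _; rewrite -expr2 sqr_ge0. Qed.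

Lemma sqr_enorm u : enorm u ^+ 2 = dotv u u.
Proof. by rewrite sqr_sqrtr// dotv_ge0. Qed.

Lemma sqr_coord_le_dotv u i : u ord0 i ^+ 2 <= dotv u u.
Proof.
rewrite /dotv (bigD1 i)//= -expr2 lerDl; apply: sumr_ge0 => j _.
by rewrite -expr2 sqr_ge0.
Qed.

Lemma dotv_eq0 u : dotv u u <= 0 -> u = 0.
Proof.
move=> u0; apply/rowP => i; rewrite mxE; apply/eqP.
by rewrite -(sqrf_eq0 (u ord0 i)) eq_le sqr_ge0 (le_trans (sqr_coord_le_dotv _ _) u0).
Qed.

End InnerProduct.

(** * Consequences of smoothness and strong convexity, and the Lyapunov step *)

Section Descent.
Context {R : realType} {d : nat}.
Variables (mu L : R) (f : 'rV[R]_d -> R) (xstar : 'rV[R]_d).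
Hypotheses (mu0 : 0 < mu) (muL : mu <= L).
Hypothesis hf : smooth_strongly_convex mu L f.
Hypothesis hxstar : forall x, f xstar <= f x.

Local Notation grad := (gradient f).

Let L0 : 0 < L. Proof. exact: lt_le_trans mu0 muL. Qed.

Lemma sqrt_step_le1 alpha : 0 < alpha -> alpha * L <= 1 ->
  Num.sqrt (mu * alpha) <= 1.
Proof.
move=> a0 aL; rewrite -sqrtr1 ler_sqrt// mulrC (le_trans _ aL)//.
by rewrite ler_pM2l.
Qed.

Lemma ssc_lower x y :
  f y + dotv (grad y) (x - y) + mu / 2 * dotv (x - y) (x - y) <= f x.
Proof. by case: hf => _ _ /(_ x y) /andP[+ _]; rewrite sqr_enorm; lra. Qed.

Lemma ssc_upper x y :
  f x <= f y + dotv (grad y) (x - y) + L / 2 * dotv (x - y) (x - y).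
Proof. by case: hf => _ _ /(_ x y) /andP[_]; rewrite sqr_enorm; lra. Qed.

(** A gradient step of length [1 / L] lowers [f] by at least [|grad x|^2 / (2 L)], and the result
    cannot lie below the minimum. *)
Lemma sqr_grad_le x : dotv (grad x) (grad x) <= 2 * L * (f x - f xstar).
Proof.
have := ssc_upper (x - L^-1 *: grad x) x; have := hxstar (x - L^-1 *: grad x).
rewrite [_ - _ - _]addrAC subrr sub0r !dotvE; set G := dotv _ _ => h1 h2.
have {h1 h2} h : f xstar <= f x - L^-1 * G / 2.
  apply: le_trans h1 _; apply: le_trans h2 _.
  have -> : L / 2 * - (L^-1 * - (L^-1 * G)) = L^-1 * G / 2.
    by field; rewrite gt_eqF.
  lra.
have -> : G = 2 * L * (L^-1 * G / 2) by field; rewrite gt_eqF.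
by rewrite ler_pM2l; [lra | rewrite mulr_gt0].
Qed.

Lemma grad_min : grad xstar = 0.
Proof. by apply: dotv_eq0; rewrite (le_trans (sqr_grad_le _))// subrr mulr0. Qed.

Lemma gap_le x : f x - f xstar <= L / 2 * dotv (x - xstar) (x - xstar).
Proof.
have := ssc_upper x xstar; rewrite grad_min.
rewrite dotv0l; lra.
Qed.

Lemma gap_ge x : mu / 2 * dotv (x - xstar) (x - xstar) <= f x - f xstar.
Proof.
have := ssc_lower x xstar; rewrite grad_min.
rewrite dotv0l; lra.
Qed.

(* Nesterov's auxiliary sequence, relative to the minimizer. *)
Definition aux (s : R) (xp x : 'rV[R]_d) : 'rV[R]_d :=
  s^-1 *: ((x - xstar) - (1 - s) *: (xp - xstar)).

Definition lyap (s : R) (xp x : 'rV[R]_d) : R :=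
  f x - f xstar + mu / 2 * dotv (aux s xp x) (aux s xp x).

(* The direction against which the noise enters the one-step inequality. *)
Definition noise_dir (alpha s : R) (xp x : 'rV[R]_d) : 'rV[R]_d :=
  let y := extrapolate mu alpha xp x in
  (L * alpha ^+ 2) *: grad y - s ^+ 2 *: (y - xstar) - (s * (1 - s)) *: aux s xp x.

(** The difference of the two sides is a sum of five nonnegative terms: the lower quadratic bounds
    from [y] to [xstar] and to [x], with weights [s] and [1 - s], the upper bound from [y] to the
    new point, and two multiples of squares. The terms linear in [e] are collected in [noise_dir];
    the contributions [- alpha] and [+ alpha] to the coefficient of [grad y] cancel there. *)
Lemma lyap_descent (alpha : R) (xp x e : 'rV[R]_d)
    (s := Num.sqrt (mu * alpha)) (y := extrapolate mu alpha xp x) :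
  0 < alpha -> alpha * L <= 1 ->
  lyap s x (y - alpha *: (grad y + e)) <=
    (1 - s) * lyap s xp x + dotv e (noise_dir alpha s xp x)
    + alpha / 2 * (1 + alpha * L) * dotv e e.
Proof.
move=> a0 aL.
have s0 : 0 < s by rewrite sqrtr_gt0 mulr_gt0.
have s2 : s ^+ 2 = mu * alpha by rewrite sqr_sqrtr// ltW// mulr_gt0.
have s1 : s <= 1 by exact: sqrt_step_le1.
pose v := aux s xp x; pose eta := y - xstar; pose G := grad y.
have sn0 : s != 0 by rewrite gt_eqF.
have s1n0 : 1 + s != 0 by rewrite gt_eqF// addr_gt0.
(* This is where the value of the momentum matters: [eta] is the average of [x - xstar] and [v] with
   weights [1 / (1 + s)] and [s / (1 + s)]. *)
have xE : x - xstar = (1 + s) *: eta - s *: v.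
  apply/rowP => i; rewrite /eta /v /aux /y /extrapolate /momentum -/s !mxE.
  by field; rewrite s1n0 sn0.
have vE : aux s x (y - alpha *: (G + e)) =
    s *: eta + (1 - s) *: v - (alpha / s) *: (G + e).
  rewrite /aux xE (_ : y - alpha *: (G + e) - xstar = eta - alpha *: (G + e)); last first.
    by rewrite /eta addrAC.
  by apply/rowP => i; rewrite !mxE; field.
have H1 := ssc_lower xstar y; have H2 := ssc_lower x y.
have H3 := ssc_upper (y - alpha *: (G + e)) y.
have Q := dotv_ge0 (eta - v); have QG := dotv_ge0 G; have Qx := dotv_ge0 (x - y).
have yE : x - y = s *: eta - s *: v.
  by rewrite -(subrKA xstar) xE -opprB -/eta; apply/rowP => i; rewrite !mxE; ring.
have etaE : y - xstar = eta by [].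
have auxE : aux s xp x = v by [].
have GE : grad y = G by [].
have extE : extrapolate mu alpha xp x = y by [].
(* The relations between the vectors are now recorded as equations; what remains is an identity
   between inner products. *)
clearbody eta v G y.
have {}H1 : f y - dotv G eta + mu / 2 * dotv eta eta <= f xstar.
  by move: H1; rewrite -[xstar - y]opprB etaE GE !dotvE opprK.
have {}H2 : f y + s * dotv G eta - s * dotv G v <= f x.
  have : f y + dotv G (x - y) <= f x.
    apply: le_trans H2; rewrite GE lerDl.
    by rewrite mulr_ge0// divr_ge0// ltW.
  by rewrite yE !dotvE addrA.
have {}H3 : f (y - alpha *: (G + e)) <= f y - alpha * (dotv G G + dotv G e)
    + L / 2 * alpha ^+ 2 * (dotv G G + 2 * dotv G e + dotv e e).
  apply: le_trans H3 _; rewrite [_ - _ - _]addrAC subrr sub0r GE !dotvE (dotvC e G).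
  by rewrite le_eqVlt; apply/orP; left; apply/eqP; ring.
rewrite /lyap /noise_dir extE -/s GE vE auxE etaE.
rewrite -subr_ge0 in H1; rewrite -subr_ge0 in H2; rewrite -subr_ge0 in H3.
(* The surplus of the squared gradient: [- alpha + L alpha^2 / 2] comes from the upper bound and
   [alpha / 2] from the square of the new auxiliary vector. *)
have aux1 : 0 <= (1 - alpha * L) * (alpha / 2) * dotv G G.
  by rewrite !mulr_ge0// ?subr_ge0// ?divr_ge0// ltW.
(* The defect in the convexity of the squared norm at [s *: eta + (1 - s) *: v]. *)
have aux2 : 0 <= mu / 2 * s * (1 - s) * dotv (eta - v) (eta - v).
  by rewrite !mulr_ge0// ?subr_ge0// ?divr_ge0// ltW.
have aux3 := mulr_ge0 (ltW s0) H1.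
have s1' : 0 <= 1 - s by rewrite subr_ge0.
have aux4 := mulr_ge0 s1' H2.
rewrite -subr_ge0; move: (addr_ge0 (addr_ge0 (addr_ge0 (addr_ge0 aux1 aux2) aux3) aux4) H3).
congr (0 <= _); rewrite !dotvE !(dotvC v) !(dotvC e) !(dotvC eta G).
(* Eliminating [mu] leaves a rational identity in [s] and [alpha], free of the square root. *)
have -> : mu = s ^+ 2 / alpha by rewrite s2 mulfK// gt_eqF.
by field; rewrite sn0 gt_eqF.
Qed.

End Descent.

(** * Borel measurability of vector-valued maps *)

Section BorelVectors.
Context {R : realType} {d : nat}.

Lemma open_rat_box (U : set 'rV[R]_d) (x : 'rV[R]_d) : open U -> U x ->
  exists q : 'rV[rat]_d * nat,
    let B := [set v : 'rV[R]_d |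
      forall i, `|v ord0 i - ratr (q.1 ord0 i)| < q.2.+1%:R^-1] in
    B x /\ B `<=` U.
Proof.
move=> oU Ux; have /nbhs_ballP[_/posnumP[e] xU] : nbhs x U by exact: open_nbhs_nbhs.
have [n _ /(_ n (leqnn _)) ne] := near_infty_natSinv_lt (e%:num / 2)%:pos.
have n0 : 0 < n.+1%:R^-1 :> R by rewrite invr_gt0.
have qP i : exists q : rat, `|x ord0 i - ratr q| < n.+1%:R^-1.
  have [q] : exists q, ratr q \in `]x ord0 i - n.+1%:R^-1, x ord0 i + n.+1%:R^-1[.
    by apply: rat_in_itvoo; rewrite ltrD2l (lt_trans _ n0)// oppr_lt0.
  by rewrite in_itv/= => /andP[q1 q2]; exists q; rewrite ltr_distlC q1.
pose q := \row_i projT1 (cid (qP i)).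
have qE i : `|x ord0 i - ratr (q ord0 i)| < n.+1%:R^-1.
  by rewrite mxE; case: cid.
exists (q, n) => /=; split => // v vq; apply: xU; split => // i j.
rewrite (ord1 i) /ball/= -(subrKA (ratr (q ord0 j))).
apply: le_lt_trans (ler_normD _ _) _; rewrite [e%:num]splitr ltrD//.
  exact: lt_trans (qE j) ne.
by rewrite distrC; exact: lt_trans (vq j) ne.
Qed.

(** An open set is a countable union of rational boxes, and the preimage of a box is a finite
    intersection of coordinate preimages. *)
Lemma measurable_fun_rV {dT} {T : measurableType dT} (h : T -> borel_rV R d) :
  (forall i, measurable_fun setT (fun t => h t ord0 i)) -> measurable_fun setT h.
Proof.
move=> mh; apply: (@measurability _ _ _ (borel_rV R d) _ _ (@open 'rV[R]_d)) => // _ [U oU <-].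
rewrite setTI.
pose B (q : 'rV[rat]_d * nat) := [set v : 'rV[R]_d |
  forall i, `|v ord0 i - ratr (q.1 ord0 i)| < q.2.+1%:R^-1].
have UE : U = \bigcup_(q in [set q | B q `<=` U]) B q.
  apply/seteqP; split => [x Ux|x [q qU /qU //]].
  by have [q [Bx BU]] := open_rat_box oU Ux; exists q.
rewrite UE preimage_bigcup bigcup_mkcond; apply: countable_bigcupT_measurable.
  exact: countableP.
move=> q; case: ifP => _ //; rewrite (_ : h @^-1` B q = \bigcap_(i in [set: 'I_d])
    ((fun t => h t ord0 i) @^-1` ball (ratr (q.1 ord0 i) : R) q.2.+1%:R^-1)); last first.
  apply/seteqP; split => t /= Bt i; first by move=> _; rewrite /ball/= distrC.
  by rewrite distrC; exact: Bt.
apply: fin_bigcap_measurable => // i _.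
rewrite -[X in measurable X]setTI; apply: mh => //.
exact: open_measurable (ball_open _ _).
Qed.

Lemma continuous_measurable_rV (h : 'rV[R]_d -> R) : continuous h ->
  measurable_fun setT (h : borel_rV R d -> R).
Proof.
move=> ch; apply: (measurability _ (RGenOpens.measurableE R)).
move=> _ [_ [a [b ->] <-]]; rewrite setTI; apply: sub_sigma_algebra.
by move/continuousP : ch; apply; exact: interval_open.
Qed.

Lemma measurable_coord i : measurable_fun setT (fun v : borel_rV R d => v ord0 i).
Proof. by apply: continuous_measurable_rV; exact: coord_continuous. Qed.

Lemma measurable_rVD {dT} {T : measurableType dT} (u v : T -> borel_rV R d) :
  measurable_fun setT u -> measurable_fun setT v ->
  measurable_fun setT (fun t => (u t : 'rV[R]_d) + v t : borel_rV R d).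
Proof.
move=> mfu mfv; apply: measurable_fun_rV => i; under eq_fun do rewrite mxE.
by apply: measurable_funD; apply: measurableT_comp (measurable_coord i) _.
Qed.

Lemma measurable_rVZ {dT} {T : measurableType dT} k (u : T -> borel_rV R d) :
  measurable_fun setT u ->
  measurable_fun setT (fun t => k *: (u t : 'rV[R]_d) : borel_rV R d).
Proof.
move=> mfu; apply: measurable_fun_rV => i; under eq_fun do rewrite mxE.
by apply: measurable_funM => //; apply: measurableT_comp (measurable_coord i) _.
Qed.

Lemma measurable_rVB {dT} {T : measurableType dT} (u v : T -> borel_rV R d) :
  measurable_fun setT u -> measurable_fun setT v ->
  measurable_fun setT (fun t => (u t : 'rV[R]_d) - v t : borel_rV R d).
Proof.
move=> mfu mfv; under eq_fun do rewrite -scaleN1r.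
by apply: measurable_rVD => //; exact: measurable_rVZ.
Qed.

End BorelVectors.

(** * Independence and mean-zero noise *)

Lemma mem_preimage_set {U V : Type} (f : U -> V) (C : set V) u :
  (u \in f @^-1` C) = (f u \in C).
Proof. by apply/idP/idP; rewrite !inE. Qed.

Section Independence.
Context {R : realType} {dO : measure_display} {Omega : measurableType dO}.
Variable P : probability Omega R.

Definition independent2 {d1 d2} {T1 : measurableType d1} {T2 : measurableType d2}
    (X : Omega -> T1) (Y : Omega -> T2) : Prop :=
  forall A B, measurable A -> measurable B ->
    P (X @^-1` A `&` Y @^-1` B) = (P (X @^-1` A) * P (Y @^-1` B))%E.

(** Independence says that the law of the pair agrees with the product law on rectangles, hence
    everywhere; Fubini does the rest. *)
Lemma integral_independent {d1 d2} {T1 : measurableType d1}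
    {T2 : measurableType d2} (X : {RV P >-> T1}) (Y : {RV P >-> T2})
    (h : T1 * T2 -> \bar R) :
  independent2 X Y -> measurable_fun setT h ->
  P.-integrable setT (fun o => h (X o, Y o)) ->
  (distribution P X \x distribution P Y)%E.-integrable setT h /\
  (\int[P]_o h (X o, Y o) =
    \int[distribution P X]_x \int[distribution P Y]_y h (x, y))%E.
Proof.
move=> XY mh ih.
have mXY : measurable_fun setT (fun o => (X o, Y o)).
  by apply: measurable_fun_pair; exact: measurable_funP.
pose XYm := isMeasurableFun.Build _ _ _ _ _ mXY.
pose XYp : {RV P >-> (T1 * T2)%type} := HB.pack (fun o => (X o, Y o)) XYm.
have mE A : measurable A ->
    (distribution P X \x distribution P Y)%E A = distribution P XYp A.
  by move=> mA; apply: product_measure_unique => // B C mB mC; exact: XY.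
have iXY : (distribution P X \x distribution P Y)%E.-integrable setT h.
  apply/integrableP; split => //.
  rewrite (eq_measure_integral (distribution P XYp)); last by move=> A mA _; exact: mE.
  rewrite ge0_integral_distribution//; last exact: measurableT_comp.
  by case/integrableP : ih.
split => //; rewrite (integral12_prod_meas1 iXY).
rewrite (eq_measure_integral (distribution P XYp)); last by move=> A mA _; exact: mE.
by rewrite (integral_distribution (X := XYp)).
Qed.

(* Conditioning on [z X] is as good as conditioning on [X]: by independence
   both conditional expectations of [h (z X, Y)] are the [Y]-average of [h]
   at the point [z X]. *)
Lemma independent_mean_zero {d1 d2 d3} {T1 : measurableType d1}
    {T2 : measurableType d2} {T3 : measurableType d3}
    (X : {RV P >-> T1}) (Y : {RV P >-> T2}) (z : T1 -> T3)
    (h : T3 * T2 -> R) (b : T1 -> R) :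
  independent2 X Y -> measurable_fun setT z -> measurable_fun setT h ->
  measurable_fun setT b ->
  P.-integrable setT (fun o => (h (z (X o), Y o))%:E) ->
  P.-integrable setT (fun o => (b (X o) * h (z (X o), Y o))%:E) ->
  (forall C, measurable C ->
    \int[P]_(o in (z \o X) @^-1` C) (h (z (X o), Y o))%:E = 0)%E ->
  (\int[P]_o (b (X o) * h (z (X o), Y o))%:E = 0)%E.
Proof.
move=> XY mz mh mb ih ibh h0.
have mZ : measurable_fun setT (z \o X) by exact: measurableT_comp.
pose Zm := isMeasurableFun.Build _ _ _ _ _ mZ.
pose Z : {RV P >-> T3} := HB.pack (z \o X) Zm.
have ZY : independent2 Z Y.
  move=> A B mA mB; have := XY (z @^-1` A) B; apply => //.
  by rewrite -[X in measurable X]setTI; exact: mz.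
have mh' : measurable_fun setT (EFin \o h) by exact/measurable_EFinP.
have [iZ _] := integral_independent ZY mh' ih.
pose H c := (\int[distribution P Y]_y (h (c, y))%:E)%E.
(* The [Y]-average [H] of [h] has zero integral over every measurable set for the law of [Z], so it
   vanishes almost everywhere. *)
have H0 : ae_eq (distribution P Z) setT H (cst 0%E).
  apply: integral_ae_eq => //; first exact: integrable_fubini_F iZ.
  move=> C _ mC; rewrite integral0 -(h0 _ mC) [RHS]integral_mkcond.
  (* Cutting [h] off outside [C] in its first argument turns an integral over an event of [Z] into
     one over the whole space, where independence applies. *)
  pose hC : T3 * T2 -> \bar R := fun p => ((EFin \o h) \_ (fst @^-1` C)) p.
  have mC' : measurable (fst @^-1` C : set (T3 * T2)).
    by rewrite -[X in measurable X]setTI; exact: measurable_fst.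
  have mhC : measurable_fun setT hC.
    by apply/(measurable_restrict _ _ _) => //; apply: measurable_funS mh'.
  have hCE : (fun o => hC (Z o, Y o)) =
      (fun o => (h (z (X o), Y o))%:E) \_ ((z \o X) @^-1` C).
    by apply/funext => o; rewrite /hC !patchE !mem_preimage_set.
  rewrite -hCE (integral_independent ZY mhC _).2; last first.
    have mZC : measurable ((z \o X) @^-1` C).
      by rewrite -[X in measurable X]setTI; exact: (mZ).
    by rewrite hCE; apply/(integrable_mkcond _ mZC); apply: integrableS ih.
  rewrite integral_mkcond; apply: eq_integral => c _; rewrite patchE.
  case: ifPn => cC; last first.
    by rewrite integral0_eq// => y _; rewrite /hC patchE mem_preimage_set/= (negbTE cC).
  by apply: eq_integral => y _; rewrite /hC patchE mem_preimage_set/= cC.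
have mbh : measurable_fun setT (fun p : T1 * T2 => (b p.1 * h (z p.1, p.2))%:E).
  apply/measurable_EFinP; apply: measurable_funM.
    exact: measurableT_comp mb measurable_fst.
  apply: measurableT_comp mh _; apply: measurable_fun_pair => //.
  exact: measurableT_comp mz measurable_fst.
have [iXY ->] := integral_independent XY mbh ibh.
rewrite -[RHS](@integral0 _ _ _ (distribution P X) setT).
apply: ae_eq_integral => //; first exact: (measurable_fubini_F iXY).
(* Outside [N] the average [H] vanishes and the section of [h] is integrable. Since [N] is null for
   the law of [z X], its preimage under [z] is null for the law of [X]; off that preimage the factor
   [b x] comes out of the inner integral. *)
have [N [mN N0 HN]] := filterI H0 (ae_integrable1 iZ).
exists (z @^-1` N); split.
- by rewrite -[X in measurable X]setTI; exact: mz.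
- exact: N0.
- move=> x /= xn; apply: HN => /= -[Hx ix]; apply: xn => _.
  under eq_integral do rewrite EFinM.
  by rewrite integralZl// -/(H (z x)) Hx// mule0.
Qed.

End Independence.

(** * Square-integrable random vectors *)

Section SquareIntegrable.
Context {R : realType} {dO : measure_display} {Omega : measurableType dO}.
Variable P : probability Omega R.

Implicit Types h : Omega -> R.

Definition integrableR (h : Omega -> R) : Prop :=
  P.-integrable setT (fun o => (h o)%:E).

Lemma integrableRD h1 h2 : integrableR h1 -> integrableR h2 ->
  integrableR (fun o => h1 o + h2 o).
Proof. by move=> i1 i2; exact: (integrableD measurableT i1 i2). Qed.

Lemma integrableRZ k h : integrableR h -> integrableR (fun o => k * h o).
Proof. by move=> i; exact: (integrableZl measurableT k i). Qed.

Lemma integrableR_cst k : integrableR (fun=> k).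
Proof. exact: (finite_measure_integrable_cst P k measurableT). Qed.

Lemma integrableR_sum (I : finType) (h : I -> Omega -> R) :
  (forall i, integrableR (h i)) -> integrableR (fun o => \sum_i h i o).
Proof.
move=> ih; rewrite /integrableR; under eq_fun do rewrite -sumEFin.
by apply: integrable_sum => // i _; exact: ih.
Qed.

Lemma integrableR_le h1 h2 : measurable_fun setT h1 -> integrableR h2 ->
  (forall o, `|h1 o| <= h2 o) -> integrableR h1.
Proof.
move=> m1 i2 h12; apply: (le_integrable measurableT _ _ i2).
  exact/measurable_EFinP.
by move=> o _ /=; rewrite lee_fin (le_trans (h12 o))// ler_norm.
Qed.

(** Measurability is a separate clause because [h ^+ 2] can be measurable when [h] is not. *)
Definition sqint (h : Omega -> R) : Prop :=
  measurable_fun setT h /\ integrableR (fun o => h o ^+ 2).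

Lemma sqint_le h1 h2 : measurable_fun setT h1 -> integrableR h2 ->
  (forall o, h1 o ^+ 2 <= h2 o) -> sqint h1.
Proof.
move=> m1 i2 h12; split => //; apply: integrableR_le i2 _.
  exact: measurable_funX.
by move=> o; rewrite ger0_norm ?sqr_ge0.
Qed.

Lemma sqint_cst k : sqint (fun=> k).
Proof. by split; [exact: measurable_cst | exact: integrableR_cst]. Qed.

Lemma sqintZ k h : sqint h -> sqint (fun o => k * h o).
Proof.
move=> [mh ih]; apply: (@sqint_le _ (fun o => k ^+ 2 * h o ^+ 2)).
- exact: measurable_funM.
- exact: integrableRZ.
- by move=> o; rewrite exprMn.
Qed.

Lemma sqintD h1 h2 : sqint h1 -> sqint h2 -> sqint (fun o => h1 o + h2 o).
Proof.
move=> [m1 i1] [m2 i2].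
apply: (@sqint_le _ (fun o => 2 * (h1 o ^+ 2 + h2 o ^+ 2))).
- exact: measurable_funD.
- exact/integrableRZ/integrableRD.
- by move=> o; have := sqr_ge0 (h1 o - h2 o); rewrite sqrrB sqrrD; lra.
Qed.

Lemma sqint_mul h1 h2 : sqint h1 -> sqint h2 -> integrableR (fun o => h1 o * h2 o).
Proof.
move=> [m1 i1] [m2 i2].
apply: (@integrableR_le _ (fun o => h1 o ^+ 2 + h2 o ^+ 2)).
- exact: measurable_funM.
- exact: integrableRD.
- move=> o; rewrite ler_norml; apply/andP; split.
    by have := sqr_ge0 (h1 o + h2 o); have := sqr_ge0 (h1 o); have := sqr_ge0 (h2 o);
       rewrite sqrrD; lra.
  by have := sqr_ge0 (h1 o - h2 o); have := sqr_ge0 (h1 o); have := sqr_ge0 (h2 o);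
     rewrite sqrrB; lra.
Qed.

Section Vectors.
Context {d : nat}.
Implicit Types u v : Omega -> 'rV[R]_d.

Definition sqintv u : Prop := forall i, sqint (fun o => u o ord0 i).

Lemma sqintv_measurable u : sqintv u -> measurable_fun setT (u : Omega -> borel_rV R d).
Proof. by move=> su; apply: measurable_fun_rV => i; case: (su i). Qed.

Lemma sqintv_cst c : sqintv (fun=> c).
Proof. by move=> i; exact: sqint_cst. Qed.

Lemma sqintvD u v : sqintv u -> sqintv v -> sqintv (fun o => u o + v o).
Proof. by move=> su sv i; under eq_fun do rewrite mxE; exact: sqintD. Qed.

Lemma sqintvZ k u : sqintv u -> sqintv (fun o => k *: u o).
Proof. by move=> su i; under eq_fun do rewrite mxE; exact: sqintZ. Qed.

Lemma sqintvB u v : sqintv u -> sqintv v -> sqintv (fun o => u o - v o).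
Proof.
move=> su sv; under eq_fun do rewrite -scaleN1r.
by apply: sqintvD su _; exact: sqintvZ.
Qed.

Lemma sqintv_dotv u v : sqintv u -> sqintv v -> integrableR (fun o => dotv (u o) (v o)).
Proof. by move=> su sv; apply: integrableR_sum => i; exact: sqint_mul. Qed.

Lemma sqintv_le u h : (forall i, measurable_fun setT (fun o => u o ord0 i)) ->
  integrableR h -> (forall o, dotv (u o) (u o) <= h o) -> sqintv u.
Proof.
move=> mu ih uh i; apply: sqint_le (mu i) ih _ => o.
exact: le_trans (sqr_coord_le_dotv _ _) (uh o).
Qed.

End Vectors.
End SquareIntegrable.

(** * One step in expectation *)

Section OneStep.
Context {R : realType} {d : nat}.
Variables (mu L : R) (f : 'rV[R]_d -> R) (xstar : 'rV[R]_d).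
Hypotheses (mu0 : 0 < mu) (muL : mu <= L).
Hypothesis hf : smooth_strongly_convex mu L f.
Hypothesis hxstar : forall x, f xstar <= f x.

Local Notation grad := (gradient f).

Let L0 : 0 < L. Proof. exact: lt_le_trans mu0 muL. Qed.

Lemma measurable_ssc : measurable_fun setT (f : borel_rV R d -> R).
Proof.
apply: continuous_measurable_rV => x; apply: differentiable_continuous.
by case: hf.
Qed.

Lemma measurable_grad : measurable_fun setT (grad : borel_rV R d -> borel_rV R d).
Proof.
apply: measurable_fun_rV => i; apply: continuous_measurable_rV => x.
case: hf => _ cg _.
apply: (@continuous_comp _ _ _ grad (fun v : 'rV[R]_d => v ord0 i)).
  exact: cg.
exact: coord_continuous.
Qed.

Lemma measurable_extrapolate {dT} {T : measurableType dT} alpha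
    (u v : T -> borel_rV R d) :
  measurable_fun setT u -> measurable_fun setT v ->
  measurable_fun setT (fun t => extrapolate mu alpha (u t) (v t) : borel_rV R d).
Proof. by move=> mfu mfv; apply: measurable_rVB; exact: measurable_rVZ. Qed.

Lemma measurable_noise_dir {dT} {T : measurableType dT} alpha s
    (u v : T -> borel_rV R d) :
  measurable_fun setT u -> measurable_fun setT v ->
  measurable_fun setT
    (fun t => noise_dir mu L f xstar alpha s (u t) (v t) : borel_rV R d).
Proof.
move=> mfu mfv.
have my : measurable_fun setT
    (fun t => extrapolate mu alpha (u t) (v t) : borel_rV R d).
  exact: measurable_extrapolate.
have mc : measurable_fun setT (fun _ : T => xstar : borel_rV R d).
  exact: measurable_cst.
apply: measurable_rVB; last apply: measurable_rVZ; last apply: measurable_rVZ.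
- apply: measurable_rVB; apply: measurable_rVZ.
    exact: measurableT_comp measurable_grad my.
  exact: measurable_rVB.
- by apply: measurable_rVB; [|apply: measurable_rVZ]; exact: measurable_rVB.
Qed.

Context {dO : measure_display} {Omega : measurableType dO}.
Variable P : probability Omega R.
Implicit Types u v : Omega -> 'rV[R]_d.

(** The squared gradient is at most [2 L] times the gap, which in turn is at most [L / 2] times the
    squared distance to [xstar]. *)
Lemma sqintv_grad u : sqintv P u -> sqintv P (fun o => grad (u o)).
Proof.
move=> su; have sd := sqintvB su (sqintv_cst P xstar).
apply: (@sqintv_le _ _ _ _ _ _
  (fun o => L ^+ 2 * dotv (u o - xstar) (u o - xstar))).
- move=> i; apply: measurableT_comp (measurable_coord i) _.
  exact: measurableT_comp measurable_grad (sqintv_measurable su).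
- exact/integrableRZ/sqintv_dotv.
- move=> o; apply: le_trans (sqr_grad_le mu0 muL hf hxstar _) _.
  have := gap_le mu0 muL hf hxstar (u o).
  rewrite -(ler_pM2l (_ : 0 < 2 * L)) ?mulr_gt0// => /le_trans; apply.
  by rewrite le_eqVlt; apply/orP; left; apply/eqP; field.
Qed.

Lemma integrable_gap u : sqintv P u -> integrableR P (fun o => f (u o) - f xstar).
Proof.
move=> su; have sd := sqintvB su (sqintv_cst P xstar).
apply: (@integrableR_le _ _ _ _ _
  (fun o => L / 2 * dotv (u o - xstar) (u o - xstar))).
- apply: measurable_funB => //.
  exact: measurableT_comp measurable_ssc (sqintv_measurable su).
- exact/integrableRZ/sqintv_dotv.
- by move=> o; rewrite ger0_norm ?subr_ge0// (gap_le mu0 muL hf hxstar).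
Qed.

Lemma sqintv_aux s u v : sqintv P u -> sqintv P v ->
  sqintv P (fun o => aux xstar s (u o) (v o)).
Proof.
move=> su sv; apply: sqintvZ; apply: sqintvB; last apply: sqintvZ;
  by apply: sqintvB => //; exact: sqintv_cst.
Qed.

Lemma sqintv_extrapolate alpha u v : sqintv P u -> sqintv P v ->
  sqintv P (fun o => extrapolate mu alpha (u o) (v o)).
Proof. by move=> su sv; apply: sqintvB; exact: sqintvZ. Qed.

Lemma sqintv_noise_dir alpha s u v : sqintv P u -> sqintv P v ->
  sqintv P (fun o => noise_dir mu L f xstar alpha s (u o) (v o)).
Proof.
move=> su sv; have sy := sqintv_extrapolate alpha su sv.
apply: sqintvB; last by apply: sqintvZ; exact: sqintv_aux.
apply: sqintvB; first by apply: sqintvZ; exact: sqintv_grad.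
by apply: sqintvZ; apply: sqintvB => //; exact: sqintv_cst.
Qed.

Lemma integrable_lyap s u v : sqintv P u -> sqintv P v ->
  integrableR P (fun o => lyap mu f xstar s (u o) (v o)).
Proof.
move=> su sv; apply: integrableRD; first exact: integrable_gap.
by apply: integrableRZ; apply: sqintv_dotv; exact: sqintv_aux.
Qed.

Context {dW : measure_display} {W : measurableType dW}.
Variables (g : 'rV[R]_d -> W -> 'rV[R]_d) (sigma : R).
Hypothesis hg : measurable_fun [set: borel_rV R d * W]
  (fun p : borel_rV R d * W => g p.1 p.2 : borel_rV R d).

(** This integrates [lyap_descent] with [e] the oracle error: the linear term has mean zero and the
    quadratic one has mean at most [sigma ^+ 2]. Square integrability of the new iterate is carried
    along so that the step can be repeated. *)
Lemma masg_step (alpha : R) (xp xc : Omega -> 'rV[R]_d) (w : {RV P >-> W})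
    (s := Num.sqrt (mu * alpha))
    (y := fun o => extrapolate mu alpha (xp o) (xc o))
    (xn := fun o => y o - alpha *: g (y o) (w o)) :
  0 < alpha -> alpha * L <= 1 -> sqintv P xp -> sqintv P xc ->
  independent2 P (fun o => (xp o, xc o) : borel_rV R d * borel_rV R d) w ->
  noisy_gradient P f sigma g y w ->
  sqintv P xn /\
  \int[P]_o lyap mu f xstar s (xc o) (xn o) <=
    (1 - s) * \int[P]_o lyap mu f xstar s (xp o) (xc o)
    + alpha / 2 * (1 + alpha * L) * sigma ^+ 2.
Proof.
move=> a0 aL sxp sxc ind [hmean [V hV V_le]].
have sy : sqintv P y by exact: sqintv_extrapolate.
have sG := sqintv_grad sy.
pose e o := g (y o) (w o) - grad (y o).
have eE o i : e o ord0 i = g (y o) (w o) ord0 i - grad (y o) ord0 i.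
  have coordB (u v : 'rV[R]_d) : (u - v) ord0 i = u ord0 i - v ord0 i by rewrite !mxE.
  exact: coordB.
have [ie iV _ intV] := hV.
have ie' : integrableR P (fun o => dotv (e o) (e o)).
  by rewrite /integrableR; under eq_fun do rewrite -sqr_enorm.
have se : sqintv P e.
  apply: sqintv_le ie' _ => // i; have [ig iG _ _] := hmean i.
  under eq_fun do rewrite eE.
  by apply: measurable_funB; [exact/measurable_EFinP/(measurable_int _ ig)
                             |exact/measurable_EFinP/(measurable_int _ iG)].
have xnE : xn = fun o => y o - alpha *: (grad (y o) + e o).
  by apply/funext => o; rewrite /xn /e [grad _ + _]addrC subrK.
have sxn : sqintv P xn.
  by rewrite xnE; apply: sqintvB sy _; apply: sqintvZ; exact: sqintvD.
split => //.
have snd := sqintv_noise_dir alpha s sxp sxc.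
(* The conditional expectation [V] of the squared error has the same total integral, by testing on
   the whole space. *)
have int_ee : \int[P]_o dotv (e o) (e o) <= sigma ^+ 2.
  have -> : \int[P]_o dotv (e o) (e o) = \int[P]_o V o.
    rewrite /Rintegral -intV; last by exists setT => //; rewrite preimage_setT setTI.
    by congr fine; apply: eq_integral => o _; rewrite -sqr_enorm.
  have mV : measurable_fun setT V by exact/measurable_EFinP/(measurable_int _ iV).
  (* The bound on [V] holds only almost surely; truncation gives a version bounded everywhere, with
     the same integral. *)
  pose V1 o := Num.min (V o) (sigma ^+ 2).
  have -> : \int[P]_o V o = \int[P]_o V1 o.
    congr fine; apply: ae_eq_integral => //; try exact/measurable_EFinP.
      by apply/measurable_EFinP; exact: measurable_minr.
    by apply: filterS V_le => o Vo _; rewrite /V1 min_l.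
  rewrite -[leRHS]mulr1 -[X in _ <= _ * X](_ : fine (P setT) = 1); last first.
    by rewrite probability_setT.
  rewrite -Rintegral_cst//; apply: le_Rintegral => //.
  - apply: (@integrableR_le _ _ _ P _ (fun o => `|V o| + sigma ^+ 2)).
    + exact: measurable_minr.
    + apply: integrableRD; last exact: integrableR_cst.
      exact: integrable_norm iV.
    + move=> o; rewrite /V1; case: (leP (V o)) => _; first by rewrite lerDl sqr_ge0.
      by rewrite ger0_norm ?sqr_ge0// lerDr.
  - exact: integrableR_cst.
  - by move=> o _; rewrite /V1 ge_min lexx orbT.
(* Coordinate by coordinate, the error is a function of the query point and the fresh noise, while
   the noise direction depends on the pair of past iterates. The oracle conditions on the query
   point alone, which is why [independent_mean_zero] is needed. *)
have int_noise : \int[P]_o dotv (e o) (noise_dir mu L f xstar alpha s (xp o) (xc o)) = 0.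
  have mxp := sqintv_measurable sxp; have mxc := sqintv_measurable sxc.
  have mX : measurable_fun setT
      (fun o => (xp o, xc o) : borel_rV R d * borel_rV R d).
    exact: measurable_fun_pair.
  pose Xm := isMeasurableFun.Build _ _ _ _ _ mX.
  pose X : {RV P >-> (borel_rV R d * borel_rV R d)%type} :=
    HB.pack (fun o => (xp o, xc o) : borel_rV R d * borel_rV R d) Xm.
  rewrite /Rintegral (_ : (\int[P]_o _)%E = 0%E)//.
  under eq_integral do rewrite -sumEFin.
  rewrite integral_sum//; last by move=> i; exact: sqint_mul.
  apply: big1 => i _; have [ig iG _ intG] := hmean i.
  pose z (p : borel_rV R d * borel_rV R d) : borel_rV R d := extrapolate mu alpha p.1 p.2.
  pose h (p : borel_rV R d * W) : R := g p.1 p.2 ord0 i - grad p.1 ord0 i.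
  pose b (p : borel_rV R d * borel_rV R d) : R :=
    noise_dir mu L f xstar alpha s p.1 p.2 ord0 i.
  under eq_integral do rewrite mulrC eE.
  apply: (@independent_mean_zero _ _ _ P _ _ _ _ _ _ X w z h b) => //.
  - exact: measurable_extrapolate measurable_fst measurable_snd.
  - apply: measurable_funB; apply: measurableT_comp (measurable_coord i) _ => //.
    exact: measurableT_comp measurable_grad measurable_fst.
  - apply: measurableT_comp (measurable_coord i) _.
    exact: measurable_noise_dir measurable_fst measurable_snd.
  - exact: (integrableB measurableT ig iG).
  - by have := sqint_mul (snd i) (se i); under eq_fun do rewrite eE.
  (* Over an event of the query point the oracle answer and the gradient have equal integrals, by
     the definition of conditional expectation. *)
  - move=> C mC; have yC : measurable (y @^-1` C).
      by rewrite -[X in measurable X]setTI; apply: (sqintv_measurable sy).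
    have Iy (k : Omega -> R) : P.-integrable setT (EFin \o k) ->
        P.-integrable (y @^-1` C) (EFin \o k).
      by apply: integrableS.
    transitivity (\int[P]_(o in y @^-1` C) ((g (y o) (w o) ord0 i)%:E
        - (grad (y o) ord0 i)%:E))%E; first by [].
    rewrite integralB_EFin//; [|exact: Iy ig|exact: Iy iG].
    rewrite intG; last by exists C => //; rewrite setTI.
    by rewrite subee// integrable_fin_num//; exact: Iy iG.
have iB := sqintv_dotv se snd.
have il := integrable_lyap s sxp sxc.
have il' := integrable_lyap s sxc sxn.
have c0 : 0 <= alpha / 2 * (1 + alpha * L).
  by rewrite mulr_ge0// ?divr_ge0 ?addr_ge0 ?mulr_ge0// ltW.
apply: (@le_trans _ _ (\int[P]_o ((1 - s) * lyap mu f xstar s (xp o) (xc o)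
    + dotv (e o) (noise_dir mu L f xstar alpha s (xp o) (xc o))
    + alpha / 2 * (1 + alpha * L) * dotv (e o) (e o)))).
  apply: le_Rintegral => //.
    by apply: integrableRD; [apply: integrableRD => //; exact: integrableRZ
                            |exact: integrableRZ].
  by move=> o _; rewrite xnE; exact: lyap_descent.
rewrite RintegralD//; last 2 first.
  by apply: integrableRD => //; exact: integrableRZ.
  exact: integrableRZ.
rewrite RintegralD//; last exact: integrableRZ.
by rewrite int_noise addr0 !RintegralZl// lerD2l ler_wpM2l.
Qed.

End OneStep.

(** * Independence from the past *)

Section Past.
Context {R : realType} {dO : measure_display} {Omega : measurableType dO}.
Variable P : probability Omega R.
Context {dW : measure_display} {W : measurableType dW} {I : choiceType}.
Variables (D : set I) (X : I -> {RV P >-> W}).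
Hypothesis indX : mutually_independent D X.

(** A pi-system generating the sigma-algebra of the variables [X i] with [i] in [D0]; mutual
    independence speaks directly about such events. *)
Definition cylinders (D0 : set I) : set (set Omega) :=
  [set E | exists (J : {fset I}) (A : I -> set W),
    [/\ [set` J] `<=` D0, forall i, measurable (A i)
      & E = \bigcap_(i in [set` J]) (X i @^-1` A i)]].

Notation past D0 := (g_sigma_algebraType (cylinders D0)).

Lemma cylinders_setI D0 : setI_closed (cylinders D0).
Proof.
move=> _ _ [J1 [A1 [J1D mA1 ->]]] [J2 [A2 [J2D mA2 ->]]].
(* An index missing from one of the two families imposes the trivial constraint [setT] there. *)
exists (J1 `|` J2)%fset; exists (fun i => (if i \in J1 then A1 i else setT) `&`
  (if i \in J2 then A2 i else setT)); split.
- by move=> i /=; rewrite inE => /orP[/J1D|/J2D].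
- by move=> i; apply: measurableI; case: ifP.
- apply/seteqP; split => [x [x1 x2] i|x xJ].
    rewrite /= inE => _; split; case: ifPn => // iJ; [exact: x1|exact: x2].
  split=> i /= iJ; have /= := xJ i; rewrite inE iJ ?orbT => /(_ isT)[].
    by [].
  by [].
Qed.

Lemma measurable_cylinder D0 E : cylinders D0 E -> measurable E.
Proof.
move=> [J [A [_ mA ->]]]; apply: fin_bigcap_measurable => // i _.
by rewrite -[X in measurable X]setTI; exact: measurable_funP.
Qed.

Lemma measurable_past D0 i : D0 i -> measurable_fun setT (X i : past D0 -> W).
Proof.
move=> iD _ B mB; rewrite setTI; apply: sub_sigma_algebra.
exists [fset i]%fset, (fun=> B); split => //.
  by move=> j /=; rewrite inE => /eqP ->.
apply/seteqP; split => [x xB j|x /(_ i)] /=; rewrite inE; last by rewrite eqxx; apply.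
by move=> /eqP ->.
Qed.

(** With [F] an event of the fresh variable [X q], the measures [E |-> P (E & F)] and
    [E |-> P F * P E] agree on cylinders, hence on the sigma-algebra that they generate, which
    contains the events of [Y]. *)
Lemma past_independent {dT} {T : measurableType dT} D0 q (Y : Omega -> T) :
  D0 `<=` D -> D q -> ~ D0 q -> measurable_fun setT (Y : past D0 -> T) ->
  independent2 P Y (X q).
Proof.
move=> D0D Dq nq mY A B mA mB.
pose F := X q @^-1` B.
have mF : measurable F by rewrite -[F]setTI; exact: measurable_funP.
have p0 : 0 <= fine (P F) by rewrite fine_ge0.
have PF : P F = (fine (P F))%:E by rewrite fineK// fin_num_measure.
have mYA : <<s cylinders D0 >> (Y @^-1` A) by have := mY measurableT A mA; rewrite setTI.
have := @g_sigma_algebra_measure_unique _ _ _ (cylinders D0)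
  (@measurable_cylinder D0) (fun=> setT) _ _
  (mrestr P mF) (mscale (NngNum p0) P) (@cylinders_setI D0) _ _ _ mYA.
rewrite /mrestr /mscale/= -/F [X in _ -> _ = (_ * X)%E]PF muleC; apply.
- move=> _; exists fset0, (fun=> setT); split => //.
  by apply/seteqP; split => // o _ i; rewrite /= inE.
- by apply/seteqP; split => // o _; exists 0%N.
- move=> _ [J [A' [JD mA' ->]]].
  have qJ : q \notin J by apply/negP => /JD.
  (* As [q] is not in [J], inserting the constraint [B] at [q] makes the intersection with [F] a
     cylinder over one more index, to which mutual independence applies. *)
  pose A2 i := if i == q then B else A' i.
  have mA2 i : measurable (A2 i) by rewrite /A2; case: ifP.
  have A2J i : i \in J -> A2 i = A' i.
    by rewrite /A2; case: eqP => // -> qJ'; rewrite qJ' in qJ.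
  have A2q : A2 q = B by rewrite /A2 eqxx.
  have capJ : \bigcap_(i in [set` J]) (X i @^-1` A' i) =
      \bigcap_(i in [set` J]) (X i @^-1` A2 i).
    by apply: eq_bigcapr => i iJ; rewrite A2J.
  have capqJ : \bigcap_(i in [set` J]) (X i @^-1` A' i) `&` F =
      \bigcap_(i in [set` (q |` J)%fset]) (X i @^-1` A2 i).
    rewrite capJ /F -A2q; apply/seteqP; split => [x [xJ xq] i|x xJ].
      by rewrite /= !inE => /orP[/eqP -> //|/xJ].
    split; last by apply: (xJ q); rewrite /= !inE eqxx.
    by move=> i iJ; apply: (xJ i); rewrite /= !inE (iJ : i \in J) orbT.
  transitivity (P F * P (\bigcap_(i in [set` J]) (X i @^-1` A' i)))%E; last first.
    by rewrite {1}PF.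
  rewrite /mrestr capqJ indX//; last first.
    by move=> i; rewrite /= !inE => /orP[/eqP -> //|/JD /D0D].
  rewrite big_fsetU1//= A2q capJ indX// => i /JD /D0D //.
- by move=> _; rewrite /mrestr setTI ltey_eq fin_num_measure.
Qed.

End Past.

(** * One stage *)

Section Iterates.
Context {R : realType} {d : nat} {dW : measure_display} {W : measurableType dW}.
Variables (g : 'rV[R]_d -> W -> 'rV[R]_d) (mu : R).
Hypothesis hg : measurable_fun [set: borel_rV R d * W]
  (fun p : borel_rV R d * W => g p.1 p.2 : borel_rV R d).

Lemma asgS alpha (w : nat -> W) x m :
  asg g mu alpha w x m.+1 = ((asg g mu alpha w x m).2,
    extrapolate mu alpha (asg g mu alpha w x m).1 (asg g mu alpha w x m).2
    - alpha *: g (extrapolate mu alpha (asg g mu alpha w x m).1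
                    (asg g mu alpha w x m).2) (w m.+1)).
Proof. by rewrite /=; case: (asg _ _ _ _ _ m). Qed.

Context {dT : measure_display} {T : measurableType dT}.

(** The source space is arbitrary, so that it can be [Omega] with the sigma-algebra generated by the
    earlier noises; measurability is therefore asked only of the noises used in the first [m]
    steps. *)
Lemma measurable_asg alpha (w : nat -> T -> W) (x : T -> borel_rV R d) m :
  measurable_fun setT x ->
  (forall i, (0 < i <= m)%N -> measurable_fun setT (w i)) ->
  measurable_fun setT
    (fun t => asg g mu alpha (w^~ t) (x t) m : borel_rV R d * borel_rV R d).
Proof.
move=> mx; elim: m => [|m IHm] mw; first exact: measurable_fun_pair.
have {IHm} : measurable_fun setT
    (fun t => asg g mu alpha (w^~ t) (x t) m : borel_rV R d * borel_rV R d).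
  by apply: IHm => i /andP[i0 im]; apply: mw; rewrite i0 leqW.
move=> /measurable_fun_pairP[m1 m2].
under eq_fun do rewrite asgS.
have my := measurable_extrapolate mu alpha m1 m2.
apply: measurable_fun_pair => //; apply: measurable_rVB => //.
apply: measurable_rVZ.
have mwm : measurable_fun setT (w m.+1) by apply: mw; rewrite /= leqnn.
exact: measurableT_comp hg (measurable_fun_pair my mwm).
Qed.

Lemma measurable_masg_init alpha n x00 (w : nat -> nat -> T -> W) k :
  (forall j i, (0 < j < k)%N -> (0 < i <= n j)%N -> measurable_fun setT (w j i)) ->
  measurable_fun setT
    (fun t => masg_init g mu alpha n x00 (fun j i => w j i t) k : borel_rV R d).
Proof.
elim: k => [|[|k] IHk] mw; [exact: measurable_cst..|].
have mi : measurable_fun setT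
    (fun t => masg_init g mu alpha n x00 (fun j i => w j i t) k.+1 : borel_rV R d).
  by apply: IHk => j i /andP[j0 jk]; apply: mw; rewrite j0 ltnW.
have mwk i : (0 < i <= n k.+1)%N -> measurable_fun setT (w k.+1 i).
  by apply: mw; rewrite /= ltnS leqnn.
by have /measurable_fun_pairP[_] := measurable_asg (alpha k.+1) mi mwk.
Qed.

End Iterates.

(** * Freshness of the noise and the bound for a whole stage *)

Section Stage.
Context {R : realType} {d : nat}.
Variables (mu L : R) (f : 'rV[R]_d -> R) (xstar : 'rV[R]_d).
Hypotheses (mu0 : 0 < mu) (muL : mu <= L).
Hypothesis hf : smooth_strongly_convex mu L f.
Hypothesis hxstar : forall x, f xstar <= f x.
Variables (x00 : 'rV[R]_d) (sigma : R) (alpha : nat -> R) (n : nat -> nat).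
Context {dO : measure_display} {Omega : measurableType dO}.
Variable P : probability Omega R.
Context {dW : measure_display} {W : measurableType dW}.
Variable g : 'rV[R]_d -> W -> 'rV[R]_d.
Hypothesis hg : measurable_fun [set: borel_rV R d * W]
  (fun p : borel_rV R d * W => g p.1 p.2 : borel_rV R d).
Variable w : nat -> nat -> {RV P >-> W}.
Hypothesis hw : mutually_independent (masg_queries n) (fun q => w q.1 q.2).
Hypothesis hnoise : forall k m : nat, masg_queries n (k, m) ->
  noisy_gradient P f sigma g
    (fun o => masg_y g mu alpha n x00 (fun j i => w j i o) k m) (w k m).

Let init k o := masg_init g mu alpha n x00 (fun j i => w j i o) k.
Let iter k m o := asg g mu (alpha k) ((w k)^~ o) (init k o) m.

Lemma iter_independent k m : (0 < k)%N -> (m < n k)%N ->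
  independent2 P (fun o => iter k m o : borel_rV R d * borel_rV R d) (w k m.+1).
Proof.
move=> k0 mk.
(* The queries that precede step [m.+1] of stage [k] in lexicographic order. *)
pose D0 := [set q : nat * nat | masg_queries n q /\
  ((q.1 < k)%N || ((q.1 == k) && (q.2 <= m)%N))].
apply: (past_independent hw (D0 := D0) (q := (k, m.+1))).
- by move=> q [].
- by rewrite /masg_queries /= k0.
- by move=> []; rewrite /= ltnn eqxx ltnn.
- pose T := g_sigma_algebraType (cylinders (fun q => w q.1 q.2) D0).
  have mwT j i : D0 (j, i) -> measurable_fun setT (w j i : T -> W).
    exact: (@measurable_past _ _ _ P _ _ _ (fun q => w q.1 q.2) D0 (j, i)).
  apply: (@measurable_asg _ _ _ _ g mu hg _ T (alpha k) (fun i => w k i : T -> W)).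
    apply: (@measurable_masg_init _ _ _ _ g mu hg _ T alpha n x00 (fun j i => w j i : T -> W)).
    move=> j i /andP[j0 jk] ij; apply: mwT; split; first by rewrite /masg_queries /= j0.
    by rewrite /= jk.
  move=> i /andP[i0 im]; apply: mwT; split.
    by rewrite /masg_queries /= k0 i0 (leq_trans im)// ltnW.
  by rewrite /= eqxx im orbT.
Qed.

(** Induction on [m] with [masg_step]: the initial value decays geometrically, and the accumulated
    noise stays below the sum of a geometric series of ratio [1 - s]. *)
Lemma stage_lyap k m (s := Num.sqrt (mu * alpha k)) :
  (0 < k)%N -> (m <= n k)%N -> 0 < alpha k -> alpha k * L <= 1 ->
  sqintv P (init k) ->
  [/\ sqintv P (fun o => (iter k m o).1), sqintv P (fun o => (iter k m o).2) &
  \int[P]_o lyap mu f xstar s (iter k m o).1 (iter k m o).2 <=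
    (1 - s) ^+ m * (2 * \int[P]_o (f (init k o) - f xstar))
    + alpha k * sigma ^+ 2 / s].
Proof.
move=> k0 + a0 aL sx.
have s0 : 0 < s by rewrite sqrtr_gt0 mulr_gt0.
have s2 : s ^+ 2 = mu * alpha k by rewrite sqr_sqrtr// ltW// mulr_gt0.
have s1 : s <= 1 by exact: (sqrt_step_le1 muL).
have c0 : 0 <= alpha k * sigma ^+ 2 / s.
  by apply: divr_ge0; [apply: mulr_ge0; [exact: ltW|exact: sqr_ge0]|exact: ltW].
elim: m => [_|m IHm mk].
  split => //; rewrite expr0 mul1r -RintegralZl//; last first.
    exact: (integrable_gap mu0 muL hf hxstar sx).
  rewrite -[leLHS]addr0 lerD//; apply: le_Rintegral => //.
  - exact: (integrable_lyap mu0 muL hf hxstar).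
  - by apply: integrableRZ; exact: (integrable_gap mu0 muL hf hxstar sx).
  - move=> o _; rewrite /lyap /aux /iter /=.
    (* At a restart the two points coincide, so the auxiliary vector is [x - xstar]; strong
       convexity then bounds the Lyapunov value by twice the gap. *)
    have -> : s^-1 *: (init k o - xstar - (1 - s) *: (init k o - xstar)) = init k o - xstar.
      by rewrite scalerBl scale1r opprB addrC subrK scalerA mulVf ?scale1r ?gt_eqF.
    by have := gap_ge mu0 muL hf hxstar (init k o); lra.
have [s1m s2m le_m] := IHm (ltnW mk).
have qk : masg_queries n (k, m.+1) by rewrite /masg_queries /= k0.
have nz := hnoise qk.
have yE : (fun o => masg_y g mu alpha n x00 (fun j i => w j i o) k m.+1) =
    (fun o => extrapolate mu (alpha k) (iter k m o).1 (iter k m o).2).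
  by apply/funext => o; rewrite /masg_y /masg_x asgS.
rewrite yE in nz.
have ind : independent2 P (fun o => ((iter k m o).1, (iter k m o).2)
    : borel_rV R d * borel_rV R d) (w k m.+1).
  by under eq_fun do rewrite -surjective_pairing; exact: iter_independent.
have [sn le_n] := masg_step mu0 muL hf hxstar hg a0 aL s1m s2m ind nz.
have iterE : (fun o => (iter k m.+1 o).2) = (fun o =>
    extrapolate mu (alpha k) (iter k m o).1 (iter k m o).2 - alpha k *:
    g (extrapolate mu (alpha k) (iter k m o).1 (iter k m o).2) (w k m.+1 o)).
  by apply/funext => o; rewrite /iter asgS.
have iterE1 : (fun o => (iter k m.+1 o).1) = (fun o => (iter k m o).2).
  by apply/funext => o; rewrite /iter asgS.
split; [by rewrite iterE1|by rewrite iterE|].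
have -> : (fun o => lyap mu f xstar s (iter k m.+1 o).1 (iter k m.+1 o).2) =
  (fun o => lyap mu f xstar s (iter k m o).2
     (extrapolate mu (alpha k) (iter k m o).1 (iter k m o).2 - alpha k *:
      g (extrapolate mu (alpha k) (iter k m o).1 (iter k m o).2) (w k m.+1 o))).
  by apply/funext => o; rewrite /iter asgS.
apply: le_trans le_n _; rewrite -/s.
(* Since [alpha k * L <= 1], the noise coefficient is at most [alpha k]. *)
apply: (@le_trans _ _ ((1 - s) * ((1 - s) ^+ m * (2 * \int[P]_o (f (init k o) - f xstar))
    + alpha k * sigma ^+ 2 / s) + alpha k * sigma ^+ 2)).
  apply: lerD; first by rewrite ler_wpM2l ?subr_ge0.
  rewrite ler_wpM2r ?sqr_ge0//.
  have : alpha k * (alpha k * L) <= alpha k * 1 by rewrite ler_pM2l.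
  by lra.
(* [alpha k * sigma ^+ 2 / s] is the fixed point of [t |-> (1 - s) * t + alpha k * sigma ^+ 2]. *)
rewrite mulrDr mulrA -exprS -addrA lerD2l le_eqVlt; apply/orP; left; apply/eqP.
by field; rewrite gt_eqF.
Qed.

(** The gap is at most the Lyapunov value, and [1 - s <= expR (- s)]. After [n k] steps the second
    component is the last iterate of the stage, from which the next stage starts. *)
Lemma stage_bound k (s := Num.sqrt (mu * alpha k)) :
  (0 < k)%N -> 0 < alpha k -> alpha k * L <= 1 -> sqintv P (init k) ->
  sqintv P (init k.+1) /\
  \int[P]_o (f (init k.+1 o) - f xstar) <=
    2 * expR (- s * (n k)%:R) * \int[P]_o (f (init k o) - f xstar)
    + alpha k * sigma ^+ 2 / s.
Proof.
move=> k0 a0 aL sx.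
have [s1 s2 le_k] := stage_lyap k0 (leqnn _) a0 aL sx.
have initE : init k.+1 = (fun o => (iter k (n k) o).2).
  by case: k k0 {s a0 aL sx s1 s2 le_k}.
have gap0 : 0 <= \int[P]_o (f (init k o) - f xstar).
  by apply: Rintegral_ge0 => o _; rewrite subr_ge0.
rewrite initE; split => //.
apply: (@le_trans _ _ (\int[P]_o lyap mu f xstar s (iter k (n k) o).1 (iter k (n k) o).2)).
  apply: le_Rintegral => //.
  - exact: (integrable_gap mu0 muL hf hxstar s2).
  - exact: (integrable_lyap mu0 muL hf hxstar).
  - by move=> o _; rewrite lerDl mulr_ge0 ?dotv_ge0// divr_ge0// ltW.
apply: le_trans le_k _; rewrite -/s lerD2r mulrA ler_wpM2r//.
rewrite [leLHS]mulrC ler_pM2l// expRM_natr lerXn2r ?nnegrE ?expR_ge0//.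
  by rewrite subr_ge0; exact: (sqrt_step_le1 muL).
by rewrite expR_ge1Dx.
Qed.

End Stage.

(** * The schedule *)

Section Counting.
Context {R : realType}.

Lemma nceil_ge (x : R) : 0 <= x -> x <= (nceil x)%:R.
Proof.
move=> x0; rewrite /nceil natr_absz ger0_norm ?ceil_ge//.
by rewrite -(@ler_int R) (le_trans x0) ?ceil_ge.
Qed.

Lemma nceil_lt (x : R) : 0 <= x -> (nceil x)%:R < x + 1.
Proof.
move=> x0; rewrite /nceil natr_absz ger0_norm; last first.
  by rewrite -(@ler_int R) (le_trans x0) ?ceil_ge.
by have := ceilB1_lt x; lra.
Qed.

(** The powers from [2 ^ 2] to [2 ^ j.+1] sum to [2 ^ j.+2 - 4]; the term [4 * M] stands on the left
    to avoid subtraction of naturals. *)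
Lemma sum_stage_lengths (n : nat -> nat) (M j : nat) :
  (forall k, (2 <= k)%N -> n k = (2 ^ k * M)%N) ->
  (\sum_(1 <= i < j.+2) n i + 4 * M = n 1%N + 2 ^ j.+2 * M)%N.
Proof.
move=> nE; elim: j => [|j IHj]; first by rewrite big_nat1.
by rewrite big_nat_recr//= addnAC IHj (nE j.+2)// (expnS 2 j.+2); lia.
Qed.

(** For the least such [j], either [j] is 0 or the bound still fails at [j - 1], which is the second
    alternative. *)
Lemma first_halving (a c : R) : 0 < c ->
  exists j : nat, a / 2 ^+ j <= c /\ (j = 0%N \/ c * 2 ^+ j < 2 * a).
Proof.
move=> c0.
have : exists j : nat, a / 2 ^+ j <= c.
  (* Any [N >= a / c] works because [N < 2 ^ N]; the maximum with 0 keeps the argument of [nceil]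
     nonnegative. *)
  exists (nceil (Num.max 0 (a / c))); set N := nceil _.
  rewrite ler_pdivrMr ?exprn_gt0// mulrC -ler_pdivrMr//.
  have : a / c <= N%:R by apply: le_trans (nceil_ge _); rewrite le_max lexx ?orbT.
  by move=> /le_trans; apply; rewrite -natrX ler_nat ltnW// ltn_expl.
move=> /ex_minnP[[|j] hj jmin]; first by exists 0%N; split => //; left.
exists j.+1; split => //; right.
have : ~~ (a / 2 ^+ j <= c) by apply/negP => /jmin; rewrite ltnn.
by rewrite -ltNge ltr_pdivlMr ?exprn_gt0// exprS mulrCA ltr_pM2l.
Qed.

End Counting.

(** * Chaining the stages and counting the iterations *)

Theorem corollary3p9 (R : realType) (d : nat)
  (mu L : R) (hmu : 0 < mu) (hmuL : mu <= L)
  (f : 'rV[R]_d -> R) (hf : smooth_strongly_convex mu L f)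
  (xstar : 'rV[R]_d) (hxstar : forall x, f xstar <= f x)
  (x00 : 'rV[R]_d) (Delta : R) (hDelta : f x00 - f xstar <= Delta)
  (eps : R) (heps0 : 0 < eps) (heps : eps < Delta)
  (sigma : R) (hsigma : 0 <= sigma)
  (alpha : nat -> R) (n : nat -> nat)
  (halpha1 : alpha 1%N = 1 / L)
  (hn1 : n 1%N = nceil (Num.sqrt (L / mu) * ln (4 * Delta / eps)))
  (halpha : forall k : nat, (2 <= k)%N -> alpha k = 1 / (2 ^+ (2 * k) * L))
  (hn : forall k : nat, (2 <= k)%N ->
     n k = (2 ^ k * nceil (Num.sqrt (L / mu) * ln 8))%N)
  (dO : measure_display) (Omega : measurableType dO) (P : probability Omega R)
  (dW : measure_display) (W : measurableType dW)
  (g : 'rV[R]_d -> W -> 'rV[R]_d)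
  (hg : measurable_fun [set: borel_rV R d * W]
     (fun p : borel_rV R d * W => g p.1 p.2 : borel_rV R d))
  (w : nat -> nat -> {RV P >-> W})
  (hw : mutually_independent (masg_queries n) (fun q => w q.1 q.2))
  (hnoise : forall k m : nat, masg_queries n (k, m) ->
     noisy_gradient P f sigma g
       (fun o => masg_y g mu alpha n x00 (fun j i => w j i o) k m) (w k m)) :
  exists k m : nat,
    [/\ (1 <= k)%N, (m <= n k)%N,
        (\sum_(1 <= j < k) n j + m <=
          nceil (Num.sqrt (L / mu) * ln (4 * Delta / eps)) +
          nceil (16 * (1 + ln 8) * (sigma ^+ 2 / (mu * eps))))%N
      & ('E_P[fun o => f (masg_x g mu alpha n x00 (fun j i => w j i o) k m.+1)]
          - (f xstar)%:E <= eps%:E)%E].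
Proof.
have L0 : 0 < L by exact: lt_le_trans hmuL.
have Delta0 : 0 < Delta by exact: lt_trans heps.
pose K := Num.sqrt (L / mu).
have K0 : 0 < K by rewrite sqrtr_gt0 divr_gt0.
have K2 : K ^+ 2 = L / mu by rewrite sqr_sqrtr// ltW// divr_gt0.
have K1 : 1 <= K by rewrite -[leLHS]sqrtr1 ler_wsqrtr// ler_pdivlMr// mul1r.
have LE : L = mu * K ^+ 2 by rewrite K2 mulrCA divff ?mulr1// gt_eqF.
pose a := sigma ^+ 2 / (mu * K).
have a0 : 0 <= a by rewrite divr_ge0 ?sqr_ge0// mulr_ge0// ltW.
have PT : fine (P setT) = 1 by rewrite probability_setT.
have ln8 : 0 <= ln 8 :> R by rewrite ln_ge0// ler1n.
(* The scale of stage [k]: the stepsize is [1 / (p k ^+ 2 * L)] and [s] is [1 / (p k * K)]. Stage 1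
   is exceptional, with scale 1 instead of 2. *)
pose p (k : nat) : R := if k == 1%N then 1 else 2 ^+ k.
have p1 k : 1 <= p k by rewrite /p; case: ifP => // _; rewrite exprn_ege1// ler1n.
have p0 k : 0 < p k by exact: lt_le_trans (p1 k).
have alphaE k : (0 < k)%N -> alpha k = (p k ^+ 2 * L)^-1.
  case: k => [//|[_|k _]]; first by rewrite halpha1 /p expr1n !mul1r.
  by rewrite halpha// /p mul1r mulnC exprM.
have sE k : (0 < k)%N -> Num.sqrt (mu * alpha k) = (p k * K)^-1.
  move=> k0; rewrite alphaE// LE (_ : mu * _ = (p k * K)^-1 ^+ 2); last first.
    by field; rewrite !gt_eqF.
  by rewrite sqrtr_sqr ger0_norm// invr_ge0 mulr_ge0// ltW.
pose init k o := masg_init g mu alpha n x00 (fun j i => w j i o) k.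
pose e k := \int[P]_o (f (init k o) - f xstar).
have stage k : (0 < k)%N -> sqintv P (init k) -> sqintv P (init k.+1) /\
    e k.+1 <= 2 * expR (- (p k * K)^-1 * (n k)%:R) * e k + a / p k.
  move=> k0 sk.
  have alpha0 : 0 < alpha k by rewrite alphaE// invr_gt0 mulr_gt0// exprn_gt0.
  have alphaL : alpha k * L <= 1.
    rewrite alphaE// invfM mulfVK ?gt_eqF// invf_le1 ?exprn_gt0//.
    exact: exprn_ege1.
  have [sk1] := stage_bound hmu hmuL hf hxstar hg hw hnoise k0 alpha0 alphaL sk.
  rewrite sE// => ek; split => //; apply: le_trans ek _.
  rewrite lerD2l le_eqVlt; apply/orP; left; apply/eqP.
  rewrite alphaE// /a LE; field.
  by rewrite !gt_eqF.
have e_ge0 k : 0 <= e k by apply: Rintegral_ge0 => o _; rewrite subr_ge0.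
have contract k x : (0 < k)%N -> p k * K * x <= (n k)%:R ->
    expR (- (p k * K)^-1 * (n k)%:R) <= expR (- x).
  move=> k0 xn; rewrite ler_expR mulNr lerN2 mulrC ler_pdivlMr ?mulr_gt0//.
  by rewrite mulrC.
(* Stage 1 gives [2 * eps / (4 * Delta) * Delta = eps / 2], plus noise [a]. Each later stage
   multiplies the previous bound by [2 / 8] and adds [a / 2 ^+ j.+2], so the [eps] part is quartered
   and the [a] part halved. *)
have bound j : sqintv P (init j.+2) /\ e j.+2 <= eps / 2 / 4 ^+ j + a / 2 ^+ j.
  elim: j => [|j [sj ej]].
    have s1 : sqintv P (init 1%N) by exact: sqintv_cst.
    have e1 : e 1%N <= Delta.
      by rewrite /e /init /= Rintegral_cst// PT mulr1.
    have [s2 e2] := stage 1%N isT s1; split => //.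
    apply: le_trans e2 _; rewrite !expr0 !divr1 lerD2r.
    (* This makes the logarithm in [n 1] nonnegative, the range where [nceil] is the usual
       ceiling. *)
    have De : 1 <= 4 * Delta / eps by rewrite ler_pdivlMr// mul1r; lra.
    have : expR (- (p 1%N * K)^-1 * (n 1%N)%:R) <= (4 * Delta / eps)^-1.
      rewrite -[leRHS]lnK ?posrE ?invr_gt0 ?(lt_le_trans ltr01 De)//.
      rewrite lnV ?posrE ?(lt_le_trans ltr01 De)//.
      apply: contract => //; rewrite hn1 /p/= mul1r nceil_ge// mulr_ge0 ?ln_ge0//.
      exact: ltW.
    move=> ex; apply: (@le_trans _ _ (2 * (4 * Delta / eps)^-1 * Delta)).
      by apply: ler_pM => //; rewrite ?mulr_ge0 ?expR_ge0// ler_pM2l.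
    by rewrite le_eqVlt; apply/orP; left; apply/eqP; field; rewrite !gt_eqF.
  have [s3 e3] := stage j.+2 isT sj; split => //.
  apply: le_trans e3 _.
  have ex : expR (- (p j.+2 * K)^-1 * (n j.+2)%:R) <= 8^-1.
    rewrite -[leRHS]lnK ?posrE// lnV ?posrE//.
    apply: contract => //; rewrite hn// natrM natrX /p/= -mulrA ler_pM2l ?exprn_gt0//.
    by rewrite nceil_ge// mulr_ge0// ltW.
  have pE : a / p j.+2 = a / 2 ^+ j / 4.
    rewrite /p /= !exprS; field.
    by rewrite expf_neq0.
  have : 2 * expR (- (p j.+2 * K)^-1 * (n j.+2)%:R) * e j.+2 <=
      2 * 8^-1 * (eps / 2 / 4 ^+ j + a / 2 ^+ j).
    by apply: ler_pM => //; rewrite ?mulr_ge0 ?expR_ge0// ler_pM2l.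
  rewrite pE => h; apply: (le_trans (lerD h (lexx _))).
  rewrite le_eqVlt; apply/orP; left; apply/eqP; rewrite !exprS; field.
  by rewrite !expf_neq0.
have [j [aj jmin]] := @first_halving R a (eps / 2) (divr_gt0 heps0 (ltr0Sn R 1)).
(* The output is the last iterate of stage [j.+1], which is the starting point of stage [j.+2]. *)
exists j.+1, (n j.+1); split => //.
- set M := nceil (K * ln 8); set Q := 16 * _ * _.
  rewrite -big_nat_recr//= -(leq_add2r (4 * M)).
  rewrite (sum_stage_lengths j hn) -hn1 -addnA leq_add2l.
  (* For [j = 0] stage 1 alone is run. Otherwise it suffices that [2 ^ j.+2 * M] fits in the second
     ceiling, by [2 ^ j.+2 < 16 * a / eps] and, as [1 <= K], [M <= K * (1 + ln 8)]. *)
  case: jmin => [-> | jmin]; first by rewrite leq_addl.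
  apply: leq_trans (leq_addr _ _); rewrite -(@ler_nat R).
  have Q0 : 0 <= Q by rewrite !mulr_ge0 ?addr_ge0 ?invr_ge0 ?sqr_ge0 ?mulr_ge0// ltW.
  apply: le_trans (nceil_ge Q0); rewrite natrM natrX.
  have M1 : M%:R <= K * (1 + ln 8).
    have := @nceil_lt R (K * ln 8) (mulr_ge0 (ltW K0) ln8).
    by rewrite -/M mulrDr mulr1; lra.
  have QE : Q = (16 * a / eps) * (K * (1 + ln 8)).
    by rewrite /Q /a; field; rewrite !gt_eqF.
  rewrite QE; apply: ler_pM => //; rewrite ler_pdivlMr// !exprS; lra.
- have [sj ej] := bound j.
  have -> : (fun o => f (masg_x g mu alpha n x00 (fun j i => w j i o) j.+1 (n j.+1).+1))
      = (fun o => f (init j.+2 o)).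
    by apply/funext => o; rewrite /masg_x asgS.
  have ig := integrable_gap hmu hmuL hf hxstar sj.
  have ifj : P.-integrable setT (EFin \o (fun o => f (init j.+2 o))).
    have := integrableRD ig (integrableR_cst P (f xstar)).
    by under eq_fun do rewrite subrK.
  rewrite unlock -(fineK (integrable_fin_num measurableT ifj)) -EFinB lee_fin.
  have -> : fine (\int[P]_o (f (init j.+2 o))%:E) - f xstar = e j.+2.
    rewrite /e RintegralB//; last exact: integrableR_cst.
    by rewrite Rintegral_cst// PT mulr1.
  (* Half of [eps] pays for the noise by the choice of [j], the other half for the contracted
     initial gap. *)
  apply: le_trans ej _; rewrite [leRHS]splitr lerD//.
  by rewrite ler_pdivrMr ?exprn_gt0// ler_peMr ?exprn_ege1 ?ler1n// divr_ge0// ltW.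
Qed.
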